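(* Let $A\in\mathbb{R}^{n\times n}$ be stable and $b\in\mathbb{R}^n$. Let $\mu_1,\ldots,\mu_s\in\mathbb{C}$ have positive real part. Let $\Lambda\in\mathbb{C}^{s\times s}$ be the lower triangular matrix with diagonal entries $\Lambda_{ii}=\mu_i$ and strictly lower triangular entries $\Lambda_{i\ell}=2\operatorname{Re}(\mu_\ell)$ for $\ell<i$, and let $\beta=(2\operatorname{Re}(\mu_1),\ldots,2\operatorname{Re}(\mu_s))^{\mathsf T}$. Then one step, with time step size $1$, of the $s$-stage Runge-Kutta iteration with tableau $(\Lambda,\beta)$ is equivalent to $s$ steps of the $1$-stage Runge-Kutta iteration with parameters $\mu_1,\ldots,\mu_s$, and equivalent to $s$ steps of the low rank ADI iteration with parameters $\alpha_j=-\mu_j^{-1}$, $j=1,\ldots,s$. Here equivalent means that all three produce the same final approximation $ZZ^{\mathsf H}$, that the two Runge-Kutta procedures produce the same final vector $h$, and that the final vector $W$ of the ADI iteration equals this $h$ up to a scalar factor of modulus one.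
   Context: A real square matrix is stable if all its eigenvalues have negative real part. $X^{\mathsf H}$ denotes the conjugate transpose. All iterations approximate the solution $\mathcal{P}$ of $A\mathcal{P}+\mathcal{P}A^{\mathsf T}+bb^{\mathsf T}=0$ by $ZZ^{\mathsf H}$. One step of the $s$-stage Runge-Kutta iteration with tableau $(\Lambda,\beta)$, $\beta$ having positive entries, and time step size $1$: with $h_0=b$, let $K\in\mathbb{C}^{n\times s}$ be the solution of $K=[Ah_0,\ldots,Ah_0]+AK\Lambda^{\mathsf T}$ (the vector $Ah_0$ is repeated $s$ times); $\mathcal{H}=[h_0,\ldots,h_0]+K\Lambda^{\mathsf T}$; $Z=\mathcal{H}\operatorname{diag}(\sqrt{\beta_1},\ldots,\sqrt{\beta_s})$; final vector $h=h_0+K\beta$. $1$-stage Runge-Kutta iteration with parameters $\mu_1,\ldots,\mu_s$: set $h_0=b$ and let $Z_0$ be the empty matrix. For $j=1,\ldots,s$: let $K_j\in\mathbb{C}^{n}$ be the solution of $(I_n-\mu_jA)K_j=Ah_{j-1}$; $\mathcal{H}_j=h_{j-1}+\mu_jK_j$; $Z_j=[Z_{j-1},\ \sqrt{2\operatorname{Re}(\mu_j)}\,\mathcal{H}_j]$; $h_j=h_{j-1}+2\operatorname{Re}(\mu_j)K_j$. Final: $Z=Z_s$, $h=h_s$. Low rank ADI iteration with parameters $\alpha_1,\ldots,\alpha_s$ of negative real part: set $W_0=b$ and let $Z_0$ be the empty matrix. For $j=1,\ldots,s$: let $V_j$ be the solution of $(A+\alpha_jI_n)V_j=W_{j-1}$;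 $W_j=W_{j-1}-2\operatorname{Re}(\alpha_j)V_j$; $Z_j=[Z_{j-1},\ \sqrt{-2\operatorname{Re}(\alpha_j)}\,V_j]$. Final: $Z=Z_s$, $W=W_s$. *)

(* Defs.v *)
(* R[i] is the field of complex numbers over R : realType. *)
From mathcomp Require Import all_boot all_order all_algebra.
From mathcomp Require Import complex reals.
Set Implicit Arguments.
Unset Strict Implicit.
Unset Printing Implicit Defensive.
Import Order.TTheory GRing.Theory Num.Theory.
Local Open Scope ring_scope.
Local Open Scope complex_scope.

Notation toC := (real_complex _).

Definition stable (R : realType) (n : nat) (A : 'M[R]_n) : Prop :=
  forall l : R[i], eigenvalue (map_mx toC A) l -> complex.Re l < 0.

(* The n x s matrix [v, ..., v]. *)
Definition repcol (R : realType) (n s : nat) (v : 'cV[R[i]]_n) :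
    'M[R[i]]_(n, s) :=
  \matrix_(i, j) v i 0.

(* The n x (j + 1) matrix [Z, v]. *)
Definition addcol (R : realType) (n j : nat)
    (Z : 'M[R[i]]_(n, j)) (v : 'cV[R[i]]_n) : 'M[R[i]]_(n, j.+1) :=
  castmx (erefl n, addn1 j) (row_mx Z v).

Definition rk_stages (R : realType) (n s : nat) (A : 'M[R[i]]_n)
    (Lambda : 'M[R[i]]_s) (h0 : 'cV[R[i]]_n) (K : 'M[R[i]]_(n, s)) : Prop :=
  K = repcol s (A *m h0) + A *m K *m Lambda^T.

(* One step, of size 1, of the s-stage Runge-Kutta iteration started at b:
   [rk_step A b Lambda beta Z h] says that its output is (Z, h). *)
Definition rk_step (R : realType) (n s : nat) (A : 'M[R[i]]_n)
    (b : 'cV[R[i]]_n) (Lambda : 'M[R[i]]_s) (beta : 'cV[R]_s)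
    (Z : 'M[R[i]]_(n, s)) (h : 'cV[R[i]]_n) : Prop :=
  exists K : 'M[R[i]]_(n, s),
    [/\ rk_stages A Lambda b K,
        Z = (repcol s b + K *m Lambda^T)
              *m diag_mx (\row_j (Num.sqrt (beta j 0))%:C)
      & h = b + K *m map_mx toC beta].

(* [rk1_iter A b mu j Z h]: after j steps (j <= s) of the 1-stage Runge-Kutta
   iteration, the approximation factor is Z and the current vector is h.
   The (j+1)-st step uses the 0-based parameter mu j. *)
Inductive rk1_iter (R : realType) (n s : nat) (A : 'M[R[i]]_n)
    (b : 'cV[R[i]]_n) (mu : 'I_s -> R[i]) :
    forall j : nat, 'M[R[i]]_(n, j) -> 'cV[R[i]]_n -> Prop :=
| rk1_init (Z : 'M[R[i]]_(n, 0)) : rk1_iter A b mu Z b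
| rk1_next (j : 'I_s) (Z : 'M[R[i]]_(n, j)) (h K : 'cV[R[i]]_n) :
    rk1_iter A b mu Z h ->
    (1%:M - mu j *: A) *m K = A *m h ->
    rk1_iter A b mu
      (addcol Z ((Num.sqrt (2 * complex.Re (mu j)))%:C *: (h + mu j *: K)))
      (h + (2 * complex.Re (mu j))%:C *: K).

(* [adi_iter A b alpha j Z W]: same convention for the low rank ADI iteration
   with approximation factor Z and residual factor W. *)
Inductive adi_iter (R : realType) (n s : nat) (A : 'M[R[i]]_n)
    (b : 'cV[R[i]]_n) (alpha : 'I_s -> R[i]) :
    forall j : nat, 'M[R[i]]_(n, j) -> 'cV[R[i]]_n -> Prop :=
| adi_init (Z : 'M[R[i]]_(n, 0)) : adi_iter A b alpha Z b
| adi_next (j : 'I_s) (Z : 'M[R[i]]_(n, j)) (W V : 'cV[R[i]]_n) :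
    adi_iter A b alpha Z W ->
    (A + (alpha j)%:M) *m V = W ->
    adi_iter A b alpha
      (addcol Z ((Num.sqrt (- 2 * complex.Re (alpha j)))%:C *: V))
      (W - (2 * complex.Re (alpha j))%:C *: V).

Definition rk_Lambda (R : realType) (s : nat) (mu : 'I_s -> R[i]) :
    'M[R[i]]_s :=
  \matrix_(i, l) if l == i then mu i
                 else if (l < i)%N then (2 * complex.Re (mu l))%:C else 0.

Definition rk_beta (R : realType) (s : nat) (mu : 'I_s -> R[i]) : 'cV[R]_s :=
  \col_i (2 * complex.Re (mu i)).

(* Main.v *)
(* Since Lambda is lower triangular, the system for the stage vectors K_j
   decouples into (I - mu_j A) K_j = A h_(j-1), where
   h_(j-1) = b + sum_(l < j) 2 Re(mu_l) K_l: these are exactly the 1-stage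
   steps, so both Runge-Kutta procedures even have the same factor Z.
   For the ADI iteration, put H_j = h_(j-1) + mu_j K_j, so that
   (I - mu_j A) H_j = h_(j-1).  If W_(j-1) = c h_(j-1), multiplying the ADI
   system by - mu_j gives V_j = - c mu_j H_j, and then
   W_j = - c (mu_j / conj mu_j) h_j.  As -2 Re(alpha_j) = 2 Re(mu_j) / |mu_j|^2,
   the columns of the two factors, too, differ by scalars of modulus one. *)
Require Import Defs.
From mathcomp Require Import all_boot all_order all_algebra.
From mathcomp Require Import complex reals.
From mathcomp Require Import ring.
Set Implicit Arguments.
Unset Strict Implicit.
Unset Printing Implicit Defensive.
Import Order.TTheory GRing.Theory Num.Theory.
Local Open Scope ring_scope.
Local Open Scope complex_scope.
Local Open Scope sesquilinear_scope.

(** * Invertibility of the shifted matrices *)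

Lemma mulmx_uniq_sol (F : fieldType) (n p : nat) (M : 'M[F]_n)
    (r : 'M[F]_(n, p)) :
  M \in unitmx -> exists! K : 'M[F]_(n, p), M *m K = r.
Proof.
move=> uM; exists (invmx M *m r); split; first by rewrite mulKVmx.
by move=> K <-; rewrite mulKmx.
Qed.

Lemma uniq_sol_ex (T : Type) (P : T -> Prop) : (exists! x, P x) -> exists x, P x.
Proof. by move=> [x [Px _]]; exists x. Qed.

(** A nonzero row vector killed by [A + z I] would be an eigenvector for [- z], whose real part is
    positive. *)
Lemma stable_addmx_unit (R : realType) (n : nat) (A : 'M[R]_n) (z : R[i]) :
  stable A -> complex.Re z < 0 -> map_mx toC A + z%:M \in unitmx.
Proof.
move=> stA z_lt0; rewrite -row_free_unit; apply: inj_row_free => v Av0.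
apply/eqP; apply: contraLR z_lt0 => v_neq0; rewrite -leNgt.
have -> : complex.Re z = - complex.Re (- z) by rewrite raddfN opprK.
rewrite oppr_ge0; apply/ltW/stA/eigenvalueP; exists v => //.
move/eqP: Av0; rewrite mulmxDr mul_mx_scalar addr_eq0 => /eqP ->.
by rewrite scaleNr.
Qed.

Lemma Re_inv_gt0 (R : realType) (z : R[i]) :
  0 < complex.Re z -> 0 < complex.Re z^-1.
Proof.
case: z => x y /= x_gt0; rewrite divr_gt0 // ltr_wpDr ?sqr_ge0 //.
by rewrite exprn_gt0.
Qed.

Lemma Re_gt0_neq0 (R : realType) (z : R[i]) : 0 < complex.Re z -> z != 0.
Proof. by apply: contraTneq => ->; rewrite /= ltxx. Qed.

Lemma stable_adi_unit (R : realType) (n : nat) (A : 'M[R]_n) (z : R[i]) :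
  stable A -> 0 < complex.Re z -> map_mx toC A + (- z^-1)%:M \in unitmx.
Proof.
move=> stA z_gt0; apply: stable_addmx_unit => //.
by rewrite raddfN oppr_lt0 Re_inv_gt0.
Qed.

(** Links the Runge-Kutta and ADI systems: it transfers invertibility and, later, compares their
    solutions. *)
Lemma scale_adi_mx (R : realType) (n : nat) (A : 'M[R[i]]_n) (z : R[i]) :
  z != 0 -> 1%:M - z *: A = - z *: (A + (- z^-1)%:M).
Proof.
move=> z_neq0; rewrite scalerDr scale_scalar_mx mulrNN divff //.
by rewrite scaleNr addrC.
Qed.

Lemma stable_rk1_unit (R : realType) (n : nat) (A : 'M[R]_n) (z : R[i]) :
  stable A -> 0 < complex.Re z -> 1%:M - z *: map_mx toC A \in unitmx.
Proof.
move=> stA z_gt0; have z_neq0 := Re_gt0_neq0 z_gt0.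
by rewrite scale_adi_mx // unitmxZ ?unitfE ?oppr_eq0 // stable_adi_unit.
Qed.

(** * Columns of the factors *)

Lemma col_addcol_lt (R : realType) (n j : nat) (Z : 'M[R[i]]_(n, j))
    (v : 'cV[R[i]]_n) (k : 'I_j.+1) (k' : 'I_j) :
  k = k' :> nat -> col k (addcol Z v) = col k' Z.
Proof.
move=> kk'; apply/matrixP => i o; rewrite !mxE castmxE /= cast_ord_id.
rewrite (_ : cast_ord _ k = lshift 1 k') ?row_mxEl //.
exact/val_inj.
Qed.

Lemma col_addcol_last (R : realType) (n j : nat) (Z : 'M[R[i]]_(n, j))
    (v : 'cV[R[i]]_n) (k : 'I_j.+1) :
  k = j :> nat -> col k (addcol Z v) = v.
Proof.
move=> kj; apply/matrixP => i o; rewrite !mxE castmxE /= cast_ord_id.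
rewrite (_ : cast_ord _ k = rshift j ord0) ?row_mxEr ?[o]ord1 //.
by apply/val_inj; rewrite /= addn0.
Qed.

(** The product is the sum of the rank-one terms [x x^H] over the columns [x], and [d] times its
    conjugate is 1. *)
Lemma col_unimodular_mul_adjoint (C : numClosedFieldType) (n s : nat)
    (X Y : 'M[C]_(n, s)) :
  (forall k, exists d : C, `|d| = 1 /\ col k Y = d *: col k X) ->
  X *m X^t* = Y *m Y^t*.
Proof.
move=> XY; apply/matrixP => i l; rewrite !mxE; apply: eq_bigr => k _.
have [d [d1 /matrixP Yd]] := XY k.
have {}Yd i' : Y i' k = d * X i' k by have := Yd i' 0; rewrite !mxE.
by rewrite !mxE !Yd rmorphM mulrACA -normCK d1 expr1n mul1r.
Qed.

(** * The triangular stage system *)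

(** The vector h_j reached after j 1-stage steps, read off from the stage matrix; j is a natural
    number so that j = s is allowed. *)
Definition rk_prefix (R : realType) (n s : nat) (b : 'cV[R[i]]_n)
    (mu : 'I_s -> R[i]) (K : 'M[R[i]]_(n, s)) (j : nat) : 'cV[R[i]]_n :=
  b + \sum_(l < s | (l < j)%N) (2 * complex.Re (mu l))%:C *: col l K.

Definition rk_substage (R : realType) (n s : nat) (b : 'cV[R[i]]_n)
    (mu : 'I_s -> R[i]) (K : 'M[R[i]]_(n, s)) (j : 'I_s) : 'cV[R[i]]_n :=
  rk_prefix b mu K j + mu j *: col j K.

Lemma rk_prefix0 (R : realType) (n s : nat) (b : 'cV[R[i]]_n)
    (mu : 'I_s -> R[i]) (K : 'M[R[i]]_(n, s)) : rk_prefix b mu K 0 = b.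
Proof. by rewrite /rk_prefix big_pred0 ?addr0. Qed.

Lemma rk_prefixS (R : realType) (n s : nat) (b : 'cV[R[i]]_n)
    (mu : 'I_s -> R[i]) (K : 'M[R[i]]_(n, s)) (j : 'I_s) :
  rk_prefix b mu K j.+1 =
  rk_prefix b mu K j + (2 * complex.Re (mu j))%:C *: col j K.
Proof.
rewrite /rk_prefix (bigD1 j) //= addrAC -addrA; congr (_ + (_ + _)).
by apply: eq_bigl => l; rewrite ltnS ltn_neqAle andbC.
Qed.

Lemma rk_prefix_full (R : realType) (n s : nat) (b : 'cV[R[i]]_n)
    (mu : 'I_s -> R[i]) (K : 'M[R[i]]_(n, s)) :
  rk_prefix b mu K s = b + K *m map_mx toC (rk_beta mu).
Proof.
congr (_ + _); apply/matrixP => i o; rewrite summxE !mxE.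
by apply: eq_big => [l | l _]; rewrite ?ltn_ord // !mxE mulrC.
Qed.

Lemma col_rk_substage (R : realType) (n s : nat) (b : 'cV[R[i]]_n)
    (mu : 'I_s -> R[i]) (K : 'M[R[i]]_(n, s)) (j : 'I_s) :
  col j (repcol s b + K *m (rk_Lambda mu)^T) = rk_substage b mu K j.
Proof.
apply/matrixP => i o; rewrite [o]ord1 !mxE -addrA; congr (_ + _).
rewrite summxE (bigD1 j) //= !mxE eqxx addrC mulrC; congr (_ + _).
(* The terms above the diagonal of [rk_Lambda mu] vanish. *)
rewrite [LHS](bigID (fun l : 'I_s => (l < j)%N)) /= [X in _ + X]big1 ?addr0.
  apply: eq_big => [l | l /andP[/negPf lj l_lt]].
    by rewrite -val_eqE /=; case: ltngtP.
  by rewrite !mxE lj l_lt mulrC.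
by move=> l /andP[/negPf lj /negPf l_ge]; rewrite !mxE lj l_ge mulr0.
Qed.

(** The system reads K = A H, where column j of H is [rk_substage b mu K j]; the term in [mu j]
    moves to the left-hand side. *)
Lemma rk_stagesP (R : realType) (n s : nat) (A : 'M[R[i]]_n)
    (b : 'cV[R[i]]_n) (mu : 'I_s -> R[i]) (K : 'M[R[i]]_(n, s)) :
  rk_stages A (rk_Lambda mu) b K <->
  forall j, (1%:M - mu j *: A) *m col j K = A *m rk_prefix b mu K j.
Proof.
have E : repcol s (A *m b) + A *m K *m (rk_Lambda mu)^T =
    A *m (repcol s b + K *m (rk_Lambda mu)^T).
  rewrite mulmxDr mulmxA; congr (_ + _); apply/matrixP => i j; rewrite !mxE.
  by apply: eq_bigr => l _; rewrite !mxE.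
rewrite /rk_stages E; set H := _ + _.
have step j : (col j K == col j (A *m H)) =
    ((1%:M - mu j *: A) *m col j K == A *m rk_prefix b mu K j).
  rewrite !colE -mulmxA -!colE col_rk_substage /rk_substage mulmxDr.
  by rewrite mulmxBl mul1mx -scalemxAl -scalemxAr subr_eq.
split=> [KH j | stepK]; first by apply/eqP; rewrite -step -KH.
apply/matrixP => i j.
have /eqP/matrixP/(_ i 0) : col j K == col j (A *m H).
  by rewrite step stepK.
by rewrite !mxE.
Qed.

(** Forward substitution: the right-hand side for column j involves only earlier columns. *)
Lemma rk_stages_inj (R : realType) (n s : nat) (A : 'M[R[i]]_n)
    (b : 'cV[R[i]]_n) (mu : 'I_s -> R[i]) (K K' : 'M[R[i]]_(n, s)) :
  (forall j, 1%:M - mu j *: A \in unitmx) ->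
  rk_stages A (rk_Lambda mu) b K -> rk_stages A (rk_Lambda mu) b K' -> K = K'.
Proof.
move=> uA /rk_stagesP HK /rk_stagesP HK'.
suff eq_col m (j : 'I_s) : (j < m)%N -> col j K = col j K'.
  apply/matrixP => i j.
  by have /matrixP/(_ i 0) := eq_col j.+1 j (leqnn _); rewrite !mxE.
elim: m j => // m IHm j jm.
rewrite -[LHS](mulKmx (uA j)) -[RHS](mulKmx (uA j)) HK HK'.
congr (_ *m (_ *m (_ + _))); apply: eq_bigr => l lj.
by rewrite IHm // (leq_trans lj).
Qed.

(** Existence follows from uniqueness, since K - A K L is a linear endomorphism of a
    finite-dimensional space. *)
Lemma rk_stages_uniq_sol (R : realType) (n s : nat) (A : 'M[R[i]]_n)
    (b : 'cV[R[i]]_n) (mu : 'I_s -> R[i]) :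
  (forall j, 1%:M - mu j *: A \in unitmx) ->
  exists! K : 'M[R[i]]_(n, s), rk_stages A (rk_Lambda mu) b K.
Proof.
move=> uA; pose L := (rk_Lambda mu)^T.
(* The matrix of this endomorphism, acting on vectorized K from the right. *)
pose M := 1%:M - lin_mx (mulmx A : 'M_(n, s) -> _) *m lin_mx (mulmxr L).
have ME (K : 'M_(n, s)) : mxvec K *m M = mxvec (K - A *m K *m L).
  by rewrite mulmxBr mulmx1 mulmxA !mul_vec_lin linearB.
have uM : M \in unitmx.
  rewrite -row_free_unit; apply: inj_row_free => v.
  rewrite -[v]vec_mxK ME => /(congr1 vec_mx); rewrite mxvecK linear0.
  move/subr0_eq => vE; suff -> : vec_mx v = 0 by rewrite linear0.
  have rep0 : repcol s (A *m 0) = 0 by apply/matrixP => i j; rewrite mulmx0 !mxE.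
  (* The homogeneous equation is the stage system for b = 0, which 0 also solves. *)
  apply: (rk_stages_inj (b := 0) uA); rewrite /rk_stages rep0 add0r //.
  by rewrite mulmx0 mul0mx.
have [K KE] : exists K : 'M_(n, s), mxvec K *m M = mxvec (repcol s (A *m b)).
  exists (vec_mx (mxvec (repcol s (A *m b)) *m invmx M)).
  by rewrite vec_mxK mulmxKV.
have HK : rk_stages A (rk_Lambda mu) b K.
  rewrite /rk_stages; move: KE; rewrite ME => /(can_inj mxvecK) <-.
  by rewrite subrK.
by exists K; split=> // K'; apply: rk_stages_inj.
Qed.

(** * The two iterations and the stage matrix *)

Lemma rk1_iter_ex (R : realType) (n s : nat) (A : 'M[R[i]]_n)
    (b : 'cV[R[i]]_n) (mu : 'I_s -> R[i]) :
  (forall j, 1%:M - mu j *: A \in unitmx) ->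
  forall j, (j <= s)%N -> exists (Z : 'M[R[i]]_(n, j)) h, rk1_iter A b mu Z h.
Proof.
move=> uA; elim=> [_ | j IHj js]; first by exists 0, b; constructor.
have [Z [h Zh]] := IHj (ltnW js).
have [K KE] := uniq_sol_ex (mulmx_uniq_sol (A *m h) (uA (Ordinal js))).
by do 2!eexists; apply: (rk1_next (j := Ordinal js)) Zh KE.
Qed.

Lemma adi_iter_ex (R : realType) (n s : nat) (A : 'M[R[i]]_n)
    (b : 'cV[R[i]]_n) (alpha : 'I_s -> R[i]) :
  (forall j, A + (alpha j)%:M \in unitmx) ->
  forall j, (j <= s)%N -> exists (Z : 'M[R[i]]_(n, j)) W, adi_iter A b alpha Z W.
Proof.
move=> uA; elim=> [_ | j IHj js]; first by exists 0, b; constructor.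
have [Z [W ZW]] := IHj (ltnW js).
have [V VE] := uniq_sol_ex (mulmx_uniq_sol W (uA (Ordinal js))).
by do 2!eexists; apply: (adi_next (j := Ordinal js)) ZW VE.
Qed.

(** By induction on the steps: the vector found in each step solves the same invertible system as
    the corresponding column of K. *)
Lemma rk1_iter_stages (R : realType) (n s : nat) (A : 'M[R[i]]_n)
    (b : 'cV[R[i]]_n) (mu : 'I_s -> R[i]) (K : 'M[R[i]]_(n, s)) :
  (forall j, 1%:M - mu j *: A \in unitmx) ->
  rk_stages A (rk_Lambda mu) b K ->
  forall j (Z : 'M[R[i]]_(n, j)) h, rk1_iter A b mu Z h ->
  h = rk_prefix b mu K j /\
  forall (k : 'I_j) (l : 'I_s), k = l :> nat ->
    col k Z = (Num.sqrt (2 * complex.Re (mu l)))%:C *: rk_substage b mu K l.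
Proof.
move=> uA /rk_stagesP HK j Z h.
elim=> {j Z h} [Z | j Z h K' _ [hE ZE] K'E].
  by rewrite rk_prefix0; split=> // -[].
have {}K'E : K' = col j K.
  by rewrite -[LHS](mulKmx (uA j)) K'E hE -HK mulKmx.
rewrite K'E rk_prefixS -hE; split=> // k l kl.
have [kj | kj] := ltnP k j.
  by rewrite (col_addcol_lt _ _ (k' := Ordinal kj)) // (ZE _ l).
have {}kj : k = j :> nat by apply/eqP; rewrite eqn_leq kj -ltnS ltn_ord.
have -> : l = j by apply/val_inj; rewrite /= -kl kj.
by rewrite col_addcol_last // /rk_substage -hE.
Qed.

Lemma Re2E (R : realType) (z : R[i]) : (2 * complex.Re z)%:C = z + Num.conj z.
Proof.
case: z => x y; apply/eqP; rewrite eq_complex /= subrr.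
by rewrite mulr2n mulrDl mul1r !eqxx.
Qed.

(** Written with z and its conjugate only, so that the ADI update becomes a field identity in two
    independent variables. *)
Lemma Re2_opp_invE (R : realType) (z : R[i]) :
  z != 0 -> (2 * complex.Re (- z^-1))%:C = - (z + Num.conj z) / (z * Num.conj z).
Proof.
have opp_invD (F : fieldType) (x y : F) :
    x != 0 -> y != 0 -> - x^-1 - y^-1 = - (x + y) / (x * y).
  by move=> x_neq0 y_neq0; field; rewrite x_neq0 y_neq0.
by move=> z_neq0; rewrite Re2E rmorphN fmorphV opp_invD // fmorph_eq0.
Qed.

(** The real part of -1/z is - Re z / |z|^2. *)
Lemma sqrt_Re_opp_invE (R : realType) (z : R[i]) :
  0 < complex.Re z ->
  (Num.sqrt (- 2 * complex.Re (- z^-1)))%:C =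
  (Num.sqrt (2 * complex.Re z))%:C / `|z|.
Proof.
move=> z_gt0.
have -> : - 2 * complex.Re (- z^-1) = 2 * complex.Re z * (ComplexField.Normc.normc z ^- 2).
  case: z z_gt0 => x y /= x_gt0; rewrite sqr_sqrtr ?addr_ge0 ?sqr_ge0 //.
  by rewrite mulrN mulNr opprK mulrA.
rewrite sqrtrM ?mulr_ge0 ?ltW // sqrtrV ?sqr_ge0 // sqrtr_sqr ger0_norm.
  by rewrite rmorphM fmorphV.
by case: (z) => x y; rewrite sqrtr_ge0.
Qed.

(* With mc the conjugate of m, one ADI step from c h against one Runge-Kutta
   step from h with stage vector k: the modulus-one factor c becomes
   - c (m / mc). *)
Lemma adi_rk_scalar (F : fieldType) (c m mc h k : F) : m != 0 -> mc != 0 ->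
  c * h - - (m + mc) / (m * mc) * (- m * c * (h + m * k)) =
  - c * (m / mc) * (h + (m + mc) * k).
Proof. by move=> m_neq0 mc_neq0; field; rewrite m_neq0 mc_neq0. Qed.

Lemma adi_iter_stages (R : realType) (n s : nat) (A : 'M[R[i]]_n)
    (b : 'cV[R[i]]_n) (mu : 'I_s -> R[i]) (K : 'M[R[i]]_(n, s)) :
  (forall j, 0 < complex.Re (mu j)) ->
  (forall j, 1%:M - mu j *: A \in unitmx) ->
  rk_stages A (rk_Lambda mu) b K ->
  forall j (Z : 'M[R[i]]_(n, j)) W,
  adi_iter A b (fun l => - (mu l)^-1) Z W ->
  (exists c : R[i], `|c| = 1 /\ W = c *: rk_prefix b mu K j) /\
  forall (k : 'I_j) (l : 'I_s), k = l :> nat -> exists d : R[i], `|d| = 1 /\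
    col k Z =
    d *: ((Num.sqrt (2 * complex.Re (mu l)))%:C *: rk_substage b mu K l).
Proof.
move=> mu_gt0 uA /rk_stagesP HK j Z W.
elim=> {j Z W} [Z | j Z W V _ [[c [c1 WE]] ZE] VE].
  by split=> [|[]//]; exists 1; rewrite normr1 scale1r rk_prefix0.
have m_neq0 := Re_gt0_neq0 (mu_gt0 j).
have mc_neq0 : Num.conj (mu j)!= 0 by rewrite fmorph_eq0.
have HE : (1%:M - mu j *: A) *m rk_substage b mu K j = rk_prefix b mu K j.
  rewrite /rk_substage mulmxDr -scalemxAr HK mulmxBl mul1mx -scalemxAl.
  by rewrite subrK.
(* Both sides have the same image under the invertible [1%:M - mu j *: A], namely [- mu j * c] times
   h_j. *)
have {}VE : V = - mu j * c *: rk_substage b mu K j.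
  rewrite -[LHS](mulKmx (uA j)) scale_adi_mx // -scalemxAl VE WE scalerA -HE.
  by rewrite -scale_adi_mx // -scalemxAr mulKmx.
split.
  exists (- c * (mu j / Num.conj (mu j))); split.
    by rewrite normrM normrN c1 mul1r normf_div norm_conjC divff ?normr_eq0.
  rewrite rk_prefixS WE VE /rk_substage Re2_opp_invE // Re2E.
  by apply/matrixP => i o; rewrite !mxE adi_rk_scalar.
move=> k l kl; have [kj | kj] := ltnP k j.
  by rewrite (col_addcol_lt _ _ (k' := Ordinal kj)) //; apply: ZE.
have {}kj : k = j :> nat by apply/eqP; rewrite eqn_leq kj -ltnS ltn_ord.
have -> : l = j by apply/val_inj; rewrite /= -kl kj.
rewrite col_addcol_last // VE sqrt_Re_opp_invE //.
(* The factor [- mu j * c] comes from V, the division by the modulus from the ADI column weight. *)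
exists (- c * (mu j / `|mu j|)); split.
  rewrite normrM normrN c1 mul1r normf_div normr_id divff //.
  by rewrite normr_eq0.
rewrite !scalerA; congr (_ *: _).
by move: (`|mu j|^-1) => r; ring.
Qed.

Theorem theorem4 (R : realType) (n s : nat) (A : 'M[R]_n) (b : 'cV[R]_n)
    (mu : 'I_s -> R[i])
    (stableA : stable A)
    (mu_gt0 : forall j : 'I_s, 0 < complex.Re (mu j)) :
  let AC : 'M[R[i]]_n := map_mx toC A in
  let bC : 'cV[R[i]]_n := map_mx toC b in
  let alpha : 'I_s -> R[i] := fun j => - (mu j)^-1 in
  [/\ (* the linear systems defining the iterates are uniquely solvable *)
      [/\ exists! K : 'M[R[i]]_(n, s), rk_stages AC (rk_Lambda mu) bC K,
          forall (j : 'I_s) (r : 'cV[R[i]]_n),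
            exists! K : 'cV[R[i]]_n, (1%:M - mu j *: AC) *m K = r
        & forall (j : 'I_s) (r : 'cV[R[i]]_n),
            exists! V : 'cV[R[i]]_n, (AC + (alpha j)%:M) *m V = r],
      (* the three procedures produce outputs *)
      [/\ exists (Z : 'M[R[i]]_(n, s)) (h : 'cV[R[i]]_n),
            rk_step AC bC (rk_Lambda mu) (rk_beta mu) Z h,
          exists (Z : 'M[R[i]]_(n, s)) (h : 'cV[R[i]]_n),
            rk1_iter AC bC mu Z h
        & exists (Z : 'M[R[i]]_(n, s)) (W : 'cV[R[i]]_n),
            adi_iter AC bC alpha Z W]
    & (* which are equivalent *)
      forall (Z Z1 Z2 : 'M[R[i]]_(n, s)) (h h1 W : 'cV[R[i]]_n),
        rk_step AC bC (rk_Lambda mu) (rk_beta mu) Z h ->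
        rk1_iter AC bC mu Z1 h1 ->
        adi_iter AC bC alpha Z2 W ->
        [/\ Z *m Z^t* = Z1 *m Z1^t*,
            Z1 *m Z1^t* = Z2 *m Z2^t*,
            h = h1
          & exists c : R[i], `|c| = 1 /\ W = c *: h]].
Proof.
move=> AC bC alpha.
have uR j : 1%:M - mu j *: AC \in unitmx by apply: stable_rk1_unit.
have uA j : AC + (alpha j)%:M \in unitmx by apply: stable_adi_unit.
have stages_uniq := rk_stages_uniq_sol bC uR.
split.
- by split=> // j r; apply: mulmx_uniq_sol.
- split; last 2 first.
  + exact: rk1_iter_ex (leqnn s).
  + exact: adi_iter_ex (leqnn s).
  by have [K HK] := uniq_sol_ex stages_uniq; do 2!eexists; exists K.
move=> Z Z1 Z2 h h1 W [K [HK ZE hE]].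
move=> /(rk1_iter_stages uR HK)[h1E Z1E].
move=> /(adi_iter_stages mu_gt0 uR HK)[WE Z2E].
(* Column j of either factor is the square root of [2 * complex.Re (mu j)] times
   [rk_substage bC mu K j]. *)
have ZZ1 : Z = Z1.
  apply/matrixP => i j.
  have /matrixP/(_ i 0) := Z1E j j erefl.
  have /matrixP/(_ i 0) := col_rk_substage bC mu K j.
  by rewrite ZE mul_mx_diag !mxE => -> ->; rewrite mulrC.
have hh1 : h = h1 by rewrite hE h1E rk_prefix_full.
split=> //; first by rewrite ZZ1.
  apply: col_unimodular_mul_adjoint => k.
  by have [d [d1 Z2d]] := Z2E k k erefl; exists d; rewrite Z2d (Z1E k k).
by rewrite hh1 h1E.
Qed.
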